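(* Let $\epsilon>0$. There exists $n_0\in\mathbb{N}$ such that for all $n\ge n_0$, $$n+\frac{1}{15}\cdot\frac{n}{\log n}\le R(\Lambda,Q_n)\le n+(1+\epsilon)\cdot\frac{n}{\log n}.$$
   Context: A copy of a poset $P_1$ in a poset $P_2$ is a subset of $P_2$ which, with the order inherited from $P_2$, is isomorphic to $P_1$. $Q_n$ denotes the Boolean lattice of all subsets of an $n$-element set ordered by inclusion. For posets $P,Q$, $R(P,Q)$ is the least $N\in\mathbb{N}$ such that every coloring of the elements of $Q_N$ with blue and red contains an all-blue copy of $P$ or an all-red copy of $Q$. $\Lambda$ is the poset on three elements $Z_1,Z_2,Z_3$ with $Z_1<Z_3$, $Z_2<Z_3$ and $Z_1,Z_2$ incomparable. $\log$ denotes the logarithm to base $2$. *)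

(* Defs.v *)
From HB Require Import structures.
From mathcomp Require Import all_boot all_order all_algebra.
From mathcomp Require Import reals exp.

Set Implicit Arguments.
Unset Strict Implicit.
Unset Printing Implicit Defensive.

Import Order.TTheory GRing.Theory Num.Theory.

(* Equips {set T} with the inclusion order. *)
Import Order.DefaultSetSubsetOrder.

Inductive Lambda : Set := Z1 | Z2 | Z3.

Definition Lambda_code (z : Lambda) : option bool :=
  match z with Z1 => Some true | Z2 => Some false | Z3 => None end.

Definition Lambda_decode (o : option bool) : Lambda :=
  match o with Some true => Z1 | Some false => Z2 | None => Z3 end.

Lemma Lambda_codeK : cancel Lambda_code Lambda_decode.
Proof. by case. Qed.

HB.instance Definition _ := Finite.copy Lambda (can_type Lambda_codeK).

Definition Lambda_le (x y : Lambda) : bool :=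
  match x, y with
  | Z1, Z1 | Z2, Z2 | _, Z3 => true
  | _, _ => false
  end.

Lemma Lambda_le_refl : reflexive Lambda_le.
Proof. by case. Qed.

Lemma Lambda_le_anti : antisymmetric Lambda_le.
Proof. by case; case. Qed.

Lemma Lambda_le_trans : transitive Lambda_le.
Proof. by case; case; case. Qed.

Fact Lambda_display : Order.disp_t.
Proof. exact: Order.Disp tt tt. Qed.

HB.instance Definition _ := Order.Le_isPOrder.Build Lambda_display Lambda
  Lambda_le_refl Lambda_le_anti Lambda_le_trans.

Definition boolean_lattice (n : nat) : finPOrderType _ := {set 'I_n}.

Lemma boolean_lattice_leE (n : nat) (A B : boolean_lattice n) :
  (A <= B)%O = ((A : {set 'I_n}) \subset (B : {set 'I_n})).
Proof. by []. Qed.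

Definition is_copy d1 d2 (P1 : finPOrderType d1) (P2 : finPOrderType d2)
    (A : {set P2}) : Prop :=
  exists f : P1 -> {x : P2 | x \in A},
    bijective f /\ forall x y : P1, (val (f x) <= val (f y))%O = (x <= y)%O.

Inductive color : Set := Blue | Red.

Definition has_mono_copy d1 d2 (P1 : finPOrderType d1) (P2 : finPOrderType d2)
    (c : P2 -> color) (a : color) : Prop :=
  exists A : {set P2}, is_copy P1 A /\ forall x, x \in A -> c x = a.

Definition ramsey_arrow d1 d2 (P : finPOrderType d1) (Q : finPOrderType d2)
    (N : nat) : Prop :=
  forall c : boolean_lattice N -> color,
    has_mono_copy P c Blue \/ has_mono_copy Q c Red.

(* R(P, Q) = N.  At most one such N exists by minimality; asserting that some N
   satisfies this also asserts that R(P, Q) is well defined. *)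
Definition is_poset_ramsey d1 d2 (P : finPOrderType d1) (Q : finPOrderType d2)
    (N : nat) : Prop :=
  ramsey_arrow P Q N /\ forall M : nat, ramsey_arrow P Q M -> (N <= M)%N.

Definition log2 (R : realType) (x : R) : R := (ln x / ln 2)%R.

(* Main.v *)
Require Import Defs.
From mathcomp Require Import all_boot all_order all_fingroup all_algebra.
From mathcomp Require Import boolp reals sequences exp.
From mathcomp Require Import zify ring lra.
Set Implicit Arguments.
Unset Strict Implicit.
Unset Printing Implicit Defensive.
Import Order.TTheory GRing.Theory Num.Theory.

(* A colouring has no blue [Lambda] iff the blue sets below any blue set form a
   chain.

   Upper bound.  Split [n + k] points as [X] and [Y] with [#|Y| = k].  For each
   ordering of [Y] there is a red copy of [Q_n] or a blue chain that picks up
   the elements of [Y] in that order.  Without blue [Lambda] the [k!] chains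
   end in distinct subsets of [X], so [k! <= 2 ^ n], which fails for
   [k = (1 + eps) n / log n].

   Lower bound.  For every [k]-subset [Y] of the [n + k] points choose a blue
   tree, branching upwards, whose branches pick up the elements of [Y] in all
   possible orders.  Every copy of [Q_n] meets one of these trees.  If sets in
   different branches or different trees are incomparable, there is no blue
   [Lambda].  Branches are separated by binary codes of the letters, which cost
   about [k log n] points, and trees by a Gilbert code of linear distance, which
   is possible for [k = n / (15 log n)]. *)

(** * Copies as order embeddings *)

Lemma has_mono_copyP d1 d2 (P1 : finPOrderType d1) (P2 : finPOrderType d2)
    (c : P2 -> color) (a : color) :
  has_mono_copy P1 c a <->
  exists g : P1 -> P2,
    (forall x y, (g x <= g y)%O = (x <= y)%O) /\ forall x, c (g x) = a.
Proof.
split=> [[A [[f [_ f_le]] cA]]|[g [g_le cg]]].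
  by exists (fun x => val (f x)); split=> // x; apply/cA/valP.
have g_inj : injective g.
  by move=> x y gxy; apply/le_anti; rewrite -!g_le gxy lexx.
have gA x : g x \in [set g x | x : P1] by exact: imset_f.
exists [set g x | x : P1]; split; last by move=> _ /imsetP[x _ ->].
exists (fun x => exist _ (g x) (gA x)); split=> //.
apply: inj_card_bij => [x y [/g_inj]//|].
by rewrite card_sig card_imset.
Qed.

Lemma Lambda_copyP (N : nat) (c : {set 'I_N} -> color) :
  has_mono_copy Lambda (c : boolean_lattice N -> color) Blue <->
  exists A B C : {set 'I_N}, [/\ c A = Blue, c B = Blue & c C = Blue] /\
    [/\ A \subset C, B \subset C, ~~ (A \subset B) & ~~ (B \subset A)].
Proof.
rewrite has_mono_copyP; split=> [[g [g_le cg]]|].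
  exists (g Z1), (g Z2), (g Z3); split=> //.
  by rewrite -!boolean_lattice_leE !g_le.
move=> [A [B [C [[cA cB cC] [AC BC nAB nBA]]]]].
have nCA : ~~ (C \subset A) by apply: contra nBA; apply: subset_trans.
have nCB : ~~ (C \subset B) by apply: contra nAB; apply: subset_trans.
exists (fun z => match z with Z1 => A | Z2 => B | Z3 => C end).
by split=> [|[]//] [] []; rewrite boolean_lattice_leE ?subxx //; apply/negbTE.
Qed.

(** * Upper bound *)

Definition is_blue (a : color) : bool := if a is Blue then true else false.

Definition prefix_set k (p : {perm 'I_k}) (j : nat) : {set 'I_k} :=
  [set p i | i : 'I_k & (i < j)%N].

Definition join_set n k (S : {set 'I_n}) (U : {set 'I_k}) : {set 'I_(n + k)} :=
  lshift k @: S :|: @rshift n k @: U.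

Lemma join_setS n k (S1 S2 : {set 'I_n}) (U1 U2 : {set 'I_k}) :
  (join_set S1 U1 \subset join_set S2 U2) = (S1 \subset S2) && (U1 \subset U2).
Proof.
apply/idP/andP => [/subsetP sub|[sS sU]]; last by rewrite setUSS ?imsetS.
split; apply/subsetP=> x xS.
  have: lshift k x \in join_set S2 U2 by rewrite sub // inE imset_f.
  case/setUP=> /imsetP[y yS /eqP]; last by rewrite eq_lrshift.
  by rewrite eq_lshift => /eqP->.
have: @rshift n k x \in join_set S2 U2 by rewrite sub // inE [_ || _]orbC imset_f.
case/setUP=> /imsetP[y yS /eqP]; first by rewrite eq_rlshift.
by rewrite eq_rshift => /eqP->.
Qed.

Lemma prefix_setS k (p : {perm 'I_k}) i j :
  (i <= j)%N -> prefix_set p i \subset prefix_set p j.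
Proof.
by move=> ij; apply/imsetS/subsetP=> x; rewrite !inE => /leq_trans->.
Qed.

Lemma card_prefix_set k (p : {perm 'I_k}) i :
  (i <= k)%N -> #|prefix_set p i| = i.
Proof.
move=> ik; rewrite card_imset; last exact: perm_inj.
have widen_inj : injective (widen_ord ik) by move=> x y [] /val_inj.
rewrite -[RHS](card_ord i) -cardsT -(card_imset _ widen_inj).
apply: eq_card => x; rewrite !inE; apply/idP/imsetP => [xm|[y _ ->]//=].
by exists (Ordinal xm) => //; apply: val_inj.
Qed.

(* There are [S_0 \subset ... \subset S_(j-1) \subset S] such that every [S_i],
   joined with the first [i] letters of [p], is blue. *)
Fixpoint ends_chain n k (c : {set 'I_(n + k)} -> color) (p : {perm 'I_k})
    (j : nat) (S : {set 'I_n}) : bool :=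
  if j is i.+1 then
    [exists S' : {set 'I_n}, [&& S' \subset S, ends_chain c p i S'
                 & is_blue (c (join_set S' (prefix_set p i)))]]
  else true.

Lemma ends_chain_subset n k (c : {set 'I_(n + k)} -> color) p j (S1 S2 : {set 'I_n}) :
  S1 \subset S2 -> ends_chain c p j S1 -> ends_chain c p j S2.
Proof.
case: j => //= j S12 /existsP[S /and3P[SS1 ? ?]]; apply/existsP.
by exists S; apply/and3P; split=> //; exact: subset_trans S12.
Qed.

Lemma ends_chain_leq n k (c : {set 'I_(n + k)} -> color) p i j S :
  (i <= j)%N -> ends_chain c p j S -> ends_chain c p i S.
Proof.
move=> /subnK<-; elim: (j - i)%N S => [//|m IHm] S; rewrite addSn /=.
by case/existsP=> S' /and3P[S'S S'c _]; apply/IHm/(ends_chain_subset S'S).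
Qed.

Lemma ends_chain_blue n k (c : {set 'I_(n + k)} -> color) p j S :
  ends_chain c p j S -> forall i, (i < j)%N ->
  exists2 S' : {set 'I_n}, S' \subset S & is_blue (c (join_set S' (prefix_set p i))).
Proof.
move=> cS i ij; have /existsP[S' /and3P[? _ ?]] := ends_chain_leq ij cS.
by exists S'.
Qed.

(* If no chain is complete, adjoin to [S] the first [l] letters of [p], where
   [l] is the length of the longest chain ending in [S]: the result is red,
   since otherwise it would extend that chain. *)
Lemma red_copy_or_chain n k (c : {set 'I_(n + k)} -> color) (p : {perm 'I_k}) :
  has_mono_copy (boolean_lattice n) (c : boolean_lattice _ -> color) Red \/
  exists S, ends_chain c p k.+1 S.
Proof.
case: (boolP [exists S, ends_chain c p k.+1 S]) => [/existsP|no_chain]; first by right.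
left; apply/has_mono_copyP.
have bound S j : ends_chain c p j S -> (j <= k)%N.
  move=> cj; rewrite leqNgt; apply: contra no_chain => kj.
  by apply/existsP; exists S; apply: ends_chain_leq cj.
have chain0 S : exists j, ends_chain c p j S by exists 0.
pose level S := ex_maxn (chain0 S) (bound S).
exists (fun S => join_set S (prefix_set p (level S))); split=> S.
  move=> S'; rewrite !boolean_lattice_leE join_setS.
  case: (boolP (S \subset S')) => //= SS'; apply: prefix_setS.
  rewrite /level; case: ex_maxnP => i ci _; case: ex_maxnP => j _; apply.
  exact: ends_chain_subset ci.
rewrite /level; case: ex_maxnP => i ci i_max.
case E: (c _) => //; have /i_max : ends_chain c p i.+1 S; last by rewrite ltnn.
by apply/existsP; exists S; apply/and3P; split; rewrite // E.
Qed.

(* Below a blue set the blue sets form a chain, so the top of a complete chain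
   for [p] determines the prefixes of [p], hence [p]. *)
Lemma ramsey_arrow_of_fact n k :
  (2 ^ n < k`!)%N -> ramsey_arrow Lambda (boolean_lattice n) (n + k).
Proof.
move=> big c; case: (EM (has_mono_copy Lambda c Blue)) => [|noL]; first by left.
case: (EM (has_mono_copy (boolean_lattice n) c Red)) => [|noQ]; first by right.
have chain p : exists S, ends_chain c p k.+1 S by case: (red_copy_or_chain c p).
have top p : exists S, ends_chain c p k S && is_blue (c (join_set S (prefix_set p k))).
  case: (chain p) => S /existsP[S' /and3P[_ ? ?]].
  by exists S'; apply/andP.
pose f p := xchoose (top p).
suff f_inj : injective f.
  have := leq_card f f_inj.
  by rewrite card_Sn -[X in (_ <= X)%N]cardsT -powersetT card_powerset cardsT card_ord leqNgt big.
move=> p q fpq.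
have blueE (a : color) : is_blue a -> a = Blue by case: a.
have prefixE j : (j <= k)%N -> prefix_set p j = prefix_set q j.
  move=> jk.
  have blue r : exists2 S : {set 'I_n}, S \subset f r & is_blue (c (join_set S (prefix_set r j))).
    have /andP[cr br] := xchooseP (top r).
    move: jk; rewrite leq_eqVlt => /orP[/eqP->|]; first by exists (f r).
    exact: ends_chain_blue cr j.
  have [[Sp Spf bp] [Sq Sqf bq]] := (blue p, blue q).
  have full r : prefix_set r k = [set: 'I_k].
    by apply/eqP; rewrite eqEcard subsetT cardsT card_ord card_prefix_set ?leqnn.
  have sub r (S : {set 'I_n}) : S \subset f p -> join_set S (prefix_set r j) \subset join_set (f p) (prefix_set p k).
    by move=> ?; rewrite join_setS full subsetT andbT.
  have [/andP[_ bt]] := xchooseP (top p).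
  have card_eq : #|prefix_set p j| = #|prefix_set q j| by rewrite !card_prefix_set.
  (* Both sets are blue and lie below the same blue set, so they are comparable; nested prefixes of
     equal size coincide. *)
  case: (boolP (join_set Sp (prefix_set p j) \subset join_set Sq (prefix_set q j))).
    by rewrite join_setS => /andP[_ s]; apply/eqP; rewrite eqEcard s card_eq leqnn.
  move=> npq; apply/esym/eqP; rewrite eqEcard card_eq leqnn andbT.
  case: (boolP (join_set Sq (prefix_set q j) \subset join_set Sp (prefix_set p j))).
    by rewrite join_setS => /andP[].
  move=> nqp; case: noL; apply/(Lambda_copyP c).
  exists (join_set Sp (prefix_set p j)), (join_set Sq (prefix_set q j)), (join_set (f p) (prefix_set p k)).
  split; first by split; apply: blueE.
  by split=> //; apply: sub; rewrite // fpq.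
apply/permP => i; apply: val_inj.
have : p i \in prefix_set q i.+1 by rewrite -prefixE ?imset_f ?inE ?ltnS.
case/imsetP => i'; rewrite inE ltnS leq_eqVlt => /orP[/eqP/val_inj->->//|i'i pq].
have : p i \in prefix_set p i by rewrite prefixE 1?ltnW // pq imset_f ?inE.
by case/imsetP=> j; rewrite inE => + /perm_inj E; rewrite -E ltnn.
Qed.

(** * Lower bound *)

Lemma injection_into (S T : finType) (B : {set T}) :
  (#|S| <= #|B|)%N -> exists f : S -> T, injective f /\ forall x, f x \in B.
Proof.
move=> SB; exists (fun x => enum_val (widen_ord SB (enum_rank x))); split=> [x y|x].
  by move=> /enum_val_inj [] /val_inj /enum_rank_inj.
exact: enum_valP.
Qed.

(** * Gilbert codes by greedy choice *)

Lemma greedy_family (T I : finType) (A : {set I}) (r : rel T) (b : nat) :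
  symmetric r -> (forall x, (#|r x| <= b)%N) -> (#|A| * b < #|T|)%N ->
  exists w : I -> T, {in A &, forall i j, i != j -> ~~ r (w i) (w j)}.
Proof.
move=> r_sym r_card A_card.
have cover (s : seq T) : (#|[set x | has (r^~ x) s]| <= size s * b)%N.
  elim: s => [|y s IHs]; first by rewrite leqn0 cards_eq0; apply/eqP/setP=> x; rewrite !inE.
  rewrite mulSn; apply: leq_trans (leq_add (r_card y) IHs).
  rewrite -[#|r y|]cardsE; apply: leq_trans (leq_card_setU _ _).
  by apply/subset_leq_card/subsetP=> x; rewrite !inE.
have [s s_size s_far] : exists2 s, size s = #|A| & pairwise (fun x y => ~~ r x y) s.
  suff: forall m, (m <= #|A|)%N ->
    exists2 s, size s = m & pairwise (fun x y => ~~ r x y) s by apply.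
  elim=> [_|m IHm mA]; first by exists [::].
  have [s s_m s_far] := IHm (ltnW mA).
  (* The [m] points chosen so far exclude at most [m * b] points, fewer than [#|T|]. *)
  have /existsP[x] : [exists x, x \notin [set x | has (r^~ x) s]].
    rewrite -negb_forall; apply/negP=> /forallP all_in.
    have := cover s; rewrite leqNgt => /negP; apply.
    rewrite (_ : [set x | has (r^~ x) s] = setT); last by apply/setP=> x; rewrite all_in inE.
    by rewrite cardsT; apply: leq_ltn_trans A_card; rewrite s_m leq_mul2r (ltnW mA) orbT.
  rewrite inE -all_predC => x_far; exists (x :: s); rewrite /= ?s_m ?s_far ?andbT //.
  by apply: sub_all x_far => y /=; rewrite r_sym.
have /card_gt0P[x0 _] : (0 < #|T|)%N by apply: leq_ltn_trans A_card.
exists (fun i => nth x0 s (index i (enum A))) => i j iA jA.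
have idx l : l \in A -> (index l (enum A) < size s)%N.
  by move=> lA; rewrite s_size cardE index_mem mem_enum.
wlog ij : i j iA jA / (index i (enum A) < index j (enum A))%N => [IH|_].
  case: (ltngtP (index i (enum A)) (index j (enum A))) => [/IH|ji|E ]; first exact.
    by rewrite eq_sym r_sym; apply: IH.
  by case/eqP; rewrite -[i](nth_index i (s := enum A)) ?mem_enum // E nth_index ?mem_enum.
by move/(pairwiseP x0): s_far; apply; rewrite ?inE ?idx.
Qed.

(** Give [u] the weight [2 ^ (a - #|u|)]: the total is [3 ^ a], and each member of the ball weighs
    at least [2 ^ a / 2 ^ t]. *)
Lemma hamming_ball_bound (a t : nat) :
  (#|[set u : {set 'I_a} | (#|u| <= t)%N]| * 2 ^ a <= 3 ^ a * 2 ^ t)%N.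
Proof.
have -> : (3 ^ a = \sum_(u : {set 'I_a}) 2 ^ (a - #|u|))%N.
  rewrite -[X in (3 ^ X)%N]card_ord -prod_nat_const.
  have /= -> := @bigA_distr _ 0 1 muln addn 'I_a (fun=> 1%N) (fun=> 2).
  apply: eq_bigr => u _; rewrite (bigID (mem u)) /= big1 => [|i ->//]; rewrite mul1n.
  rewrite (eq_bigr (fun=> 2)) => [|i /negbTE->//].
  rewrite (eq_bigl (mem (~: u))) => [|i]; last by rewrite !inE.
  by rewrite prod_nat_const cardsCs setCK card_ord.
rewrite -sum_nat_const big_distrl /= [leqRHS](bigID (mem [set u : {set 'I_a} | (#|u| <= t)%N])) /=.
apply: leq_trans (leq_addr _ _); apply: leq_sum => u; rewrite inE => u_t.
rewrite -expnD leq_exp2l //; lia.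
Qed.

Definition sym_diff a (w u : {set 'I_a}) : {set 'I_a} :=
  [set i | (i \in w) (+) (i \in u)].

Lemma sym_diffC a (w u : {set 'I_a}) : sym_diff w u = sym_diff u w.
Proof. by apply/setP=> i; rewrite !inE addbC. Qed.

Lemma sym_diffK a (w : {set 'I_a}) : involutive (sym_diff w).
Proof. by move=> u; apply/setP=> i; rewrite !inE addbA addbb. Qed.


Lemma gilbert_code (I : finType) (A : {set I}) (a t : nat) :
  (#|A| * (3 ^ a * 2 ^ t) < 2 ^ (a + a))%N ->
  exists w : I -> {set 'I_a},
    {in A &, forall i j, i != j -> (t < #|sym_diff (w i) (w j)|)%N}.
Proof.
move=> small; pose ball := [set u : {set 'I_a} | (#|u| <= t)%N].
pose r (v u : {set 'I_a}) := sym_diff v u \in ball.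
have [||| w w_far] := @greedy_family _ _ A r #|ball|.
- by move=> u v; rewrite /r sym_diffC.
- move=> v; rewrite -(card_preimset ball (can_inj (@sym_diffK _ v))).
  by apply/eq_leq/eq_card => u; rewrite [RHS]inE.
- rewrite -cardsT -powersetT card_powerset cardsT card_ord.
  rewrite -(ltn_pmul2r (expn_gt0 2 a)) -expnD -mulnA; apply: leq_ltn_trans small.
  by rewrite leq_mul2l hamming_ball_bound orbT.
by exists w => i j iA jA /(w_far _ _ iA jA); rewrite /r inE -ltnNge.
Qed.

(* All these sets have [a] elements and the codeword set of [~: w] is disjoint
   from that of [w]: this leaves room for the tree built on top of it. *)
Definition codeword_set (E : finType) a (f : 'I_a * bool -> E) (w : {set 'I_a}) : {set E} :=
  [set f (i, i \in w) | i : 'I_a].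

Lemma mem_codeword_set (E : finType) a (f : 'I_a * bool -> E) w i b :
  injective f -> (f (i, b) \in codeword_set f w) = (b == (i \in w)).
Proof.
move=> f_inj; apply/imsetP/eqP => [[j _ /f_inj[-> ->]//]|->].
by exists i.
Qed.

Lemma leq_exp2rW m n e : (m <= n)%N -> (m ^ e <= n ^ e)%N.
Proof. by case: e => // e; rewrite leq_exp2r. Qed.

Lemma bin_leq_exp (N k : nat) : ('C(N, k) <= N ^ k)%N.
Proof.
apply: leq_trans (leq_pmulr _ (fact_gt0 k)) _; rewrite bin_ffact.
elim: k => // k IHk; rewrite ffactnSr expnSr leq_mul //; exact: leq_subr.
Qed.

(** * Families of separated trees *)

Definition tree_index N k (Y : {set 'I_N}) (s : seq 'I_N) : bool :=
  [&& #|Y| == k, uniq s & all (mem Y) s].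

(* [T Y s] is the node of the [Y]-th tree at the end of the branch [s], a
   repetition-free word over [Y]; its trace on [Y] is the set of letters of [s]. *)
Definition tree_family N k (T : {set 'I_N} -> seq 'I_N -> {set 'I_N}) : Prop :=
  [/\ forall Y s, tree_index k Y s -> T Y s :&: Y = [set x in s],
      forall Y s1 s2, prefix s1 s2 -> T Y s1 \subset T Y s2
    & forall Y1 s1 Y2 s2, tree_index k Y1 s1 -> tree_index k Y2 s2 ->
        T Y1 s1 \subset T Y2 s2 -> Y1 = Y2 /\ prefix s1 s2].

Lemma tree_index_size N k (Y : {set 'I_N}) s : tree_index k Y s -> (size s <= k)%N.
Proof.
case/and3P=> /eqP<- s_uniq /allP sY; rewrite -(card_uniqP s_uniq).
by apply/subset_leq_card/subsetP=> x /sY.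
Qed.

(* [T Y s] is a codeword set for [Y] without [Y], plus the letters of [s], plus
   for each position [i] the graph of the binary code of the [i]-th letter,
   placed in the [i]-th block of the complementary codeword set.  The blocks
   separate the branches of one tree.  Distinct trees are separated because the
   code has distance [t], which exceeds what two copies of [Y] and one set of
   blocks can hide.  The counts fit since [3 ^ 5 < 2 ^ 8]. *)
Lemma tree_family_exists (N k L : nat) :
  (0 < L)%N -> (N <= 2 ^ L)%N -> (10 * (k * L + k + 1) <= N)%N ->
  exists T, @tree_family N k T.
Proof.
move=> L_gt0 NL k_small; pose q := (N %/ 10)%N; pose a := (5 * q)%N.
have q_big : (k * L + k < q)%N by rewrite /q; lia.
have aN : (a * 2 <= N)%N by rewrite /a /q; lia.
have N_gt0 : (0 < N)%N by lia.
pose y0 : 'I_N := Ordinal N_gt0.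
have [f [f_inj _]] : exists f : 'I_a * bool -> 'I_N, injective f /\ forall x, f x \in setT.
  by apply: injection_into; rewrite card_prod card_ord card_bool cardsT card_ord.
have [g [g_inj _]] : exists g : 'I_N -> {ffun 'I_L -> bool}, injective g /\ forall x, g x \in setT.
  by apply: injection_into; rewrite cardsT card_ffun card_bool !card_ord.
pose Ys := [set Y : {set 'I_N} | #|Y| == k].
pose t := (2 * k + k * L)%N.
have [|w w_far] := @gilbert_code _ Ys a t.
  rewrite /Ys card_draws card_ord.
  (* The exponents add up to [8 * q + 2 * (k * L + k)], which is below [a + a = 10 * q] by
     [q_big]. *)
  apply: (@leq_ltn_trans (2 ^ (k * L) * (2 ^ (8 * q) * 2 ^ t))%N).
    apply: leq_mul.
      apply: leq_trans (bin_leq_exp _ _) _.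
      by rewrite mulnC expnM leq_exp2rW.
    rewrite leq_mul2r; apply/orP; right.
    by rewrite /a !expnM leq_exp2rW.
  by rewrite -!expnD ltn_exp2l // /t /a; lia.
have room Y : exists e : 'I_k * 'I_L * bool -> 'I_N, Y \in Ys ->
    injective e /\ forall x, e x \in codeword_set f (~: w Y) :\: Y.
  case: (boolP (Y \in Ys)) => [|_]; last by exists (fun=> y0).
  rewrite inE => /eqP Yk.
  have [|e e_inj] := @injection_into ('I_k * 'I_L * bool)%type _ (codeword_set f (~: w Y) :\: Y).
    rewrite !card_prod !card_ord card_bool cardsD card_imset => [|i j /f_inj[]//].
    have := subset_leq_card (subsetIr (codeword_set f (~: w Y)) Y).
    by rewrite Yk card_ord /a; lia.
  by exists e.
have [e eP] := choice room.
pose codes Y s := [set e Y (il.1, il.2, g (nth y0 s il.1) il.2)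
                     | il : 'I_k * 'I_L & (il.1 < size s)%N].
pose T Y s := codeword_set f (w Y) :\: Y :|: [set x in s] :|: codes Y s.
have tree_Ys Y s : tree_index k Y s -> Y \in Ys by case/and3P; rewrite inE.
have tree_sub (Y : {set 'I_N}) s : tree_index k Y s -> [set x in s] \subset Y.
  by case/and3P=> _ _ /allP sY; apply/subsetP=> x; rewrite inE => /sY.
have codesN Y s x : Y \in Ys -> x \in codes Y s -> x \notin Y.
  by case/eP=> _ e_out /imsetP[il _ ->]; have /setDP[] := e_out (il.1, il.2, g (nth y0 s il.1) il.2).
exists T; split=> [Y s Ys_tree|Y s1 s2 /prefixP[s ->]|Y1 s1 Y2 s2 tree1 tree2 sub12].
- apply/setP=> x; rewrite [in LHS]inE /T [x \in _ :|: codes _ _]inE [x \in _ :|: [set x in s]]inE.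
  rewrite [x \in _ :\: _]inE.
  case: (boolP (x \in Y)) => xY /=; rewrite ?andbF ?andbT.
    case: (boolP (x \in codes Y s)) => [/(codesN _ _ _ (tree_Ys _ _ Ys_tree))|]; first by rewrite xY.
    by rewrite orbF.
  by apply/esym/negbTE; apply: contra xY; apply/subsetP/tree_sub.
- apply: setUSS; first by apply/setUS/subsetP=> x; rewrite !inE mem_cat => ->.
  apply/subsetP=> _ /imsetP[il + ->]; rewrite inE => il_s; apply/imsetP; exists il.
    by rewrite inE size_cat ltn_addr.
  by rewrite nth_cat il_s.
have Y12 : Y1 = Y2.
  apply/eqP/negP=> /negP /(w_far _ _ (tree_Ys _ _ tree1) (tree_Ys _ _ tree2)).
  rewrite ltnNge => /negP; apply.
  (* These points of the codeword set of [Y1] are missed by that of [Y2], so [Y1], [Y2] or the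
     blocks must account for them. *)
  pose F := [set f (i, i \in w Y1) | i in sym_diff (w Y1) (w Y2)].
  have <- : #|F| = #|sym_diff (w Y1) (w Y2)| by rewrite card_imset // => i j /f_inj[].
  have F_sub : F \subset Y1 :|: (Y2 :|: codes Y2 s2).
    apply/subsetP=> _ /imsetP[i + ->]; rewrite inE => i_diff; rewrite inE.
    case: (boolP (_ \in Y1)) => //= xY1.
    have /(subsetP sub12) : f (i, i \in w Y1) \in T Y1 s1.
      by rewrite !inE xY1 mem_codeword_set // eqxx.
    rewrite [_ \in T _ _]inE [_ \in _ :|: [set x in _]]inE [_ \in _ :\: _]inE.
    rewrite mem_codeword_set // [_ == _]negbTE ?andbF /=; last first.
      by move: i_diff; case: (_ \in _); case: (_ \in _).
    by case/orP=> [/(subsetP (tree_sub _ _ tree2))|] x_in; rewrite inE x_in ?orbT.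
  apply: leq_trans (subset_leq_card F_sub) _.
  apply: leq_trans (leq_card_setU _ _) _.
  have := leq_card_setU Y2 (codes Y2 s2) => /leq_of_leqif card_U.
  have card_codes : (#|codes Y2 s2| <= k * L)%N.
    apply: leq_trans (leq_imset_card _ _) _.
    by apply: leq_trans (max_card _) _; rewrite card_prod !card_ord.
  move: (tree_Ys _ _ tree1) (tree_Ys _ _ tree2); rewrite !inE => /eqP-> /eqP Y2k.
  rewrite Y2k in card_U; rewrite /t mul2n -addnn -addnA leq_add2l.
  by apply: leq_trans card_U _; rewrite leq_add2l.
split=> //; rewrite -{}Y12 in tree2 sub12.
have [e_inj e_out] := eP _ (tree_Ys _ _ tree1).
have agree i : (i < size s1)%N -> forall l, (i < size s2)%N /\ g (nth y0 s1 i) l = g (nth y0 s2 i) l.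
  move=> i_s1 l; have ik := leq_trans i_s1 (tree_index_size tree1).
  have : e Y1 (Ordinal ik, l, g (nth y0 s1 i) l) \in T Y1 s1.
    by rewrite inE; apply/orP; right; apply/imsetP; exists (Ordinal ik, l); rewrite ?inE.
  move/(subsetP sub12); have /setDP[] := e_out (Ordinal ik, l, g (nth y0 s1 i) l).
  case/imsetP=> j _ e_eq eY.
  rewrite [_ \in T _ _]inE [_ \in _ :|: [set x in _]]inE => /orP[/orP[]|].
  - by rewrite inE e_eq mem_codeword_set // inE; case: (_ \in w _); rewrite andbF.
  - by move/(subsetP (tree_sub _ _ tree2)); rewrite (negbTE eY).
  by case/imsetP=> [[i' l']] i's /e_inj[ii' ll' ->]; move: i's; rewrite inE -ii' -ll'.
have size12 : (size s1 <= size s2)%N.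
  rewrite leqNgt; apply/negP=> size21.
  (* Since [0 < L], every block has a bit to betray the extra position [size s2]. *)
  by have [] := agree _ size21 (Ordinal L_gt0); rewrite ltnn.
rewrite prefixE; apply/eqP/(@eq_from_nth _ y0); rewrite size_takel // => i i_s1.
rewrite nth_take //; apply/esym/g_inj/ffunP=> l.
by have [] := agree i i_s1 l.
Qed.

(* A copy of [Q_n] in [Q_(n+k)] restricts to the identity on [n] suitable
   coordinates: pick one in [g [set i]] outside [g [set~ i]] for each [i]. *)
Lemma good_embedding (n N : nat) (g : {set 'I_n} -> {set 'I_N}) :
  (forall A B, (g A \subset g B) = (A \subset B)) ->
  exists x : 'I_n -> 'I_N, injective x /\ forall A i, (x i \in g A) = (i \in A).
Proof.
move=> g_sub.
have pick i : exists y, y \in g [set i] /\ y \notin g [set~ i].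
  have /subsetPn[y] : ~~ (g [set i] \subset g [set~ i]) by rewrite g_sub sub1set !inE eqxx.
  by exists y.
have [x xP] := choice pick.
have xE A i : (x i \in g A) = (i \in A).
  have [x_in x_out] := xP i; apply/idP/idP => [xA|iA].
    apply: contraR x_out => iA; apply: (subsetP _ _ xA); rewrite g_sub.
    by apply/subsetP=> j jA; rewrite !inE; apply: contraNneq iA => <-.
  by apply: (subsetP _ _ x_in); rewrite g_sub sub1set.
exists x; split=> // i j xij; have := xE [set i] j.
by rewrite -xij xE !inE eqxx => /esym/eqP.
Qed.

(* Colour the trees blue.  Given a red copy of [Q_n], let [Y] be the complement
   of the coordinates of [good_embedding] and climb the [Y]-tree: at the node
   [T Y s] the red set with the same trace outside [Y] differs from it, so its
   trace on [Y] contains a further letter [y], and the climb goes on to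
   [rcons s y].  After [k] steps no letter is left. *)
Lemma no_ramsey_arrow (n k L : nat) :
  (0 < L)%N -> (n + k <= 2 ^ L)%N -> (10 * (k * L + k + 1) <= n + k)%N ->
  ~ ramsey_arrow Lambda (boolean_lattice n) (n + k).
Proof.
move=> L_gt0 NL k_small arrow.
have [T [T_Y T_mono T_sep]] := tree_family_exists L_gt0 NL k_small.
pose blue A := exists Y s, tree_index k Y s /\ A = T Y s.
pose c (A : boolean_lattice (n + k)) := if `[< blue A >] then Blue else Red.
have cB A : c A = Blue -> blue A by rewrite /c; case: asboolP.
have cR A : c A = Red -> ~ blue A by rewrite /c; case: asboolP.
case: (arrow c).
  case/(Lambda_copyP c) => A [B [C [[/cB[Y1 [s1 [tr1 ->]]] /cB[Y2 [s2 [tr2 ->]]] /cB[Y [s [tr ->]]]]]]].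
  case=> /(T_sep _ _ _ _ tr1 tr)[-> pre1] /(T_sep _ _ _ _ tr2 tr)[-> pre2].
  move: pre1 pre2; rewrite !prefixE => /eqP<- /eqP<-.
  case: (leqP (size s1) (size s2)) => [le12|/ltnW le21] n12 n21.
    by case/negP: n12; apply: T_mono; rewrite -(take_takel _ le12) prefix_take.
  by case/negP: n21; apply: T_mono; rewrite -(take_takel _ le21) prefix_take.
case/has_mono_copyP=> g [g_le g_red].
have g_sub (A B : {set 'I_n}) : (g A \subset g B) = (A \subset B) by exact: g_le.
have [x [x_inj xE]] := good_embedding g_sub.
pose Y := ~: [set x i | i : 'I_n].
have Yk : #|Y| = k by rewrite cardsCs setCK card_imset // !card_ord; lia.
(* The climb is run to length [k.+1], which no repetition-free word over [Y] attains. *)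
have walk j : (j <= k.+1)%N -> exists s, [/\ size s = j, tree_index k Y s &
    [set y in s] \subset g [set i | x i \in T Y s]].
  elim: j => [|j IHj] jk.
    exists [::]; split=> //; first by rewrite /tree_index Yk eqxx.
    by apply/subsetP=> y; rewrite inE.
  have [s [s_size s_tree s_sub]] := IHj (ltnW jk).
  set A := [set i | x i \in T Y s] in s_sub.
  have [y [yY yA ys]] : exists y, [/\ y \in Y, y \in g A & y \notin s].
    case: (pickP [pred y | [&& y \in Y, y \in g A & y \notin s]]) => [y /and3P[]|none].
      by exists y.
    (* Without a new letter, [g A] would be the blue node [T Y s] itself. *)
    case: (cR _ (g_red A)); exists Y, s; split=> //; apply/setP=> y.
    case: (boolP (y \in Y)) => yY.
      have := none y; rewrite /= yY /= => /negbT; rewrite negb_and negbK => ygs.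
      have /setP/(_ y) := T_Y _ _ s_tree; rewrite in_setI yY andbT inE => ->.
      apply/idP/idP => [yg|ys]; first by move: ygs; rewrite yg.
      by apply: (subsetP s_sub); rewrite inE.
    by move: yY; rewrite inE negbK => /imsetP[i _ ->]; rewrite xE inE.
  have s'_tree : tree_index k Y (rcons s y).
    case/and3P: s_tree => Yk' s_uniq sY.
    by rewrite /tree_index Yk' rcons_uniq ys s_uniq all_rcons sY /= yY.
  exists (rcons s y); split=> //; first by rewrite size_rcons s_size.
  apply: (@subset_trans _ _ (mem (g A))).
    apply/subsetP=> z; rewrite inE mem_rcons inE => /orP[/eqP->//|zs].
    by apply: (subsetP s_sub); rewrite inE.
  rewrite g_sub; apply/subsetP=> i; rewrite !inE; apply/subsetP/T_mono.
  exact: prefix_rcons.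
have [s [s_size /tree_index_size + _]] := walk k.+1 (leqnn _).
by rewrite s_size ltnn.
Qed.

(** * The least [N] between the two bounds *)

Lemma ramsey_arrow_geq (n M : nat) :
  ramsey_arrow Lambda (boolean_lattice n) M -> (n <= M)%N.
Proof.
move=> /(_ (fun=> Red)) [/has_mono_copyP[g [_ /(_ Z1)]]//|/has_mono_copyP[g [g_le _]]].
have [x [x_inj _]] := @good_embedding n M g g_le.
by have := leq_card x x_inj; rewrite !card_ord.
Qed.

(** If the least [N] were at most [n + k1], the tree colouring with [k = N - n] would refute the
    arrow at [N] itself. *)
Lemma poset_ramsey_between (n k1 L k2 : nat) :
  (0 < L)%N -> (n + k1 <= 2 ^ L)%N -> (10 * (k1 * L + k1 + 1) <= n)%N ->
  (2 ^ n < k2`!)%N ->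
  exists N, is_poset_ramsey Lambda (boolean_lattice n) N /\ (n + k1 < N <= n + k2)%N.
Proof.
move=> L_gt0 n_le k1_small k2_big.
have exN : exists N, `[< ramsey_arrow Lambda (boolean_lattice n) N >].
  by exists (n + k2)%N; apply/asboolP/ramsey_arrow_of_fact.
case: (ex_minnP exN) => N /asboolP arrow N_min; exists N; split.
  by split=> // M arrowM; apply/N_min/asboolP.
rewrite N_min ?andbT; last exact/asboolP/ramsey_arrow_of_fact.
rewrite ltnNge; apply/negP=> N_le; have n_N := ramsey_arrow_geq arrow.
move: arrow; rewrite -(subnKC n_N).
apply: (@no_ramsey_arrow _ _ L) => //; first by rewrite subnKC // (leq_trans N_le).
have : ((N - n) * L <= k1 * L)%N by rewrite leq_mul2r; lia.
lia.
Qed.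

(** * Asymptotics *)

Local Open Scope ring_scope.

(** This is [k! >= (k / e) ^ k]; the induction step is [k * ln (1 + 1 / k) <= 1]. *)
Lemma ln_fact_ge (R : realType) (k : nat) :
  (0 < k)%N -> k%:R * (ln k%:R - 1) <= ln k`!%:R :> R.
Proof.
elim: k => // -[_ _|k IHk _]; first by rewrite ln1 mul1r sub0r lerN10.
have := IHk isT; rewrite [k.+2`!]factS natrM lnM ?posrE ?ltr0n ?fact_gt0 //.
have k_gt0 : 0 < k.+1%:R :> R by rewrite ltr0n.
have : ln (k.+2%:R) - ln (k.+1%:R) <= k.+1%:R^-1 :> R.
  rewrite -ln_div ?posrE ?ltr0n // -natr1 mulrDl divff ?gt_eqF // mul1r.
  by apply: le_ln1Dx; rewrite (lt_trans _ (_ : 0 < _)) ?invr_gt0 // ltrN10.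
rewrite -(ler_pM2l k_gt0) divff ?gt_eqF // => step IH.
have : k.+2%:R = k.+1%:R + 1 :> R by rewrite natr1.
move: (ln _) (ln _) (ln _) step IH => a b f step IH ->.
nra.
Qed.

Lemma fact_gt_pow2 (R : realType) (n k : nat) :
  (0 < k)%N -> n%:R * ln 2 < k%:R * (ln k%:R - 1) :> R -> (2 ^ n < k`!)%N.
Proof.
move=> k_gt0 /lt_le_trans/(_ (@ln_fact_ge R _ k_gt0)).
rewrite mulr_natl -lnXn // ltr_ln ?posrE ?ltr0n ?fact_gt0 ?exprn_gt0 //.
by rewrite -natrX ltr_nat.
Qed.

Lemma pow2_trunc_log_bound (R : realType) (n k : nat) :
  (2 <= n)%N -> k%:R <= 1 / 15 * (n%:R / log2 n%:R) :> R ->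
  (15 * k * trunc_log 2 n <= n)%N.
Proof.
move=> n_ge2; rewrite /log2.
have z_gt0 : 0 < ln n%:R :> R by rewrite ln_gt0 // ltr1n.
have l2_gt0 : 0 < ln 2 :> R by rewrite ln_gt0 // ltr1n.
have tl : (trunc_log 2 n)%:R * ln 2 <= ln n%:R :> R.
  rewrite mulr_natl -lnXn // ler_ln ?posrE ?exprn_gt0 ?ltr0n //; last by lia.
  by rewrite -natrX ler_nat trunc_logP //; lia.
rewrite invf_div (mulrA n%:R) (mulrA (1 / 15)) ler_pdivlMr // => kz.
rewrite -(ler_nat R) !natrM -(ler_pM2r l2_gt0).
have : k%:R * ((trunc_log 2 n)%:R * ln 2) <= k%:R * ln n%:R :> R by rewrite ler_wpM2l.
move: kz; rewrite !mulrA; lra.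
Qed.

(* With [e = eps / 2] and [u = n / log2 n], eventually [(1 + e) u < k], and it
   suffices that [ln n < (1 + e) (ln u - 1)]; this is [ln ln n = o(ln n)], obtained
   from [ln (d z) <= d z - 1] at [z = ln n] with [(1 + e) d = e / 2]. *)
Lemma fact_gt_pow2_eventually (R : realType) (eps : R) : 0 < eps ->
  exists n0 : nat, forall n k : nat, (n0 <= n)%N ->
    (1 + eps) * (n%:R / log2 n%:R) < k.+1%:R :> R -> (2 ^ n < k`!)%N.
Proof.
move=> eps_gt0.
have [e e_gt0 ->] : exists2 e, 0 < e & eps = 2 * e.
  by exists (eps / 2); [rewrite divr_gt0|field].
have [d d_gt0 dE] : exists2 d, 0 < d & (1 + e) * d = e / 2.
  exists (e / (2 * (1 + e))); last by field; lra.
  by rewrite divr_gt0 // mulr_gt0 // addr_gt0.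
have l2_gt0 : 0 < ln 2 :> R by rewrite ln_gt0 // ltr1n.
(* The first summand will give [1 < e * u]; the second absorbs the constants in [ln u]. *)
pose z0 : R := 4 / (e * ln 2) + `|2 * (1 + e) * (- ln (ln 2) - ln d) / e|.
exists (Num.trunc (expR z0)).+1 => n k n_big k_big.
have z_big : z0 < ln n%:R.
  rewrite -[z0]expRK ltr_ln ?posrE ?expR_gt0 //.
    by apply: lt_le_trans (truncnS_gt _) _; rewrite ler_nat.
  by rewrite ltr0n; lia.
have n_gt0 : 0 < n%:R :> R by rewrite ltr0n; lia.
set z := ln n%:R in z_big; have nE : n%:R = expR z by rewrite lnK.
have z1 : 4 < z * (e * ln 2).
  rewrite -ltr_pdivrMr ?mulr_gt0 //; apply: le_lt_trans z_big.
  by rewrite lerDl normr_ge0.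
have z2 : (1 + e) * (- ln (ln 2) - ln d) < e * z / 2.
  have : 2 * (1 + e) * (- ln (ln 2) - ln d) / e < z.
    apply: le_lt_trans z_big; apply: le_trans (ler_norm _) _.
    by rewrite lerDr divr_ge0 // mulr_ge0 // ltW.
  rewrite ltr_pdivrMr //; lra.
have z_gt0 : 0 < z.
  by rewrite -(pmulr_lgt0 _ (mulr_gt0 e_gt0 l2_gt0)); apply: lt_trans z1.
have n_ge : z ^+ 2 / 4 <= n%:R.
  have -> : z ^+ 2 / 4 = (z / 2) ^+ 2 by field.
  have -> : n%:R = expR (z / 2) ^+ 2 by rewrite nE expr2 -expRD; congr expR; field.
  rewrite ler_sqr ?nnegrE ?expR_ge0 //; last by rewrite divr_ge0 // ltW.
  by apply: le_trans (expR_ge1Dx _); lra.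
pose u : R := n%:R * ln 2 / z.
have uE : n%:R / log2 n%:R = u by rewrite /log2 invf_div mulrA.
have u_gt0 : 0 < u by rewrite divr_gt0 // mulr_gt0.
have eu : 1 < e * u.
  rewrite /u mulrA ltr_pdivlMr // mul1r.
  have : z * (z * (e * ln 2)) <= 4 * n%:R * (e * ln 2).
    by rewrite mulrA ler_pM2r ?mulr_gt0 //; rewrite -expr2; lra.
  have : z * 4 < z * (z * (e * ln 2)) by rewrite ltr_pM2l.
  lra.
(* Half of [eps] pays for rounding: [1 < e * u] turns a bound on [k.+1] into one on [k]. *)
have k_ge : (1 + e) * u < k%:R.
  move: k_big; rewrite uE -natr1.
  lra.
have ln_u : ln u = z + ln (ln 2) - ln z.
  by rewrite ln_div ?lnM ?posrE // mulr_gt0.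
have ln_z : ln z <= z * d - 1 - ln d.
  have := @le_ln1Dx R (z * d - 1); rewrite (_ : 1 + (z * d - 1) = z * d); last by ring.
  rewrite lnM ?posrE //.
  have : 0 < z * d by rewrite mulr_gt0.
  lra.
have ln_u_big : z < (1 + e) * (ln u - 1).
  rewrite ln_u; have : (1 + e) * ln z <= (1 + e) * (z * d - 1 - ln d) by rewrite ler_pM2l //; lra.
  have : (1 + e) * (z * d) = z * (e / 2) by rewrite mulrCA dE.
  lra.
have k_gt0 : (0 < k)%N.
  by rewrite -(ltr0n R); apply: lt_trans k_ge; rewrite mulr_gt0 //; lra.
apply: (@fact_gt_pow2 R) => //.
have -> : n%:R * ln 2 = u * z by rewrite /u divfK // gt_eqF.
have ln_k : ln u <= ln k%:R.
  by rewrite ler_ln ?posrE ?ltr0n //; nra.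
have : u * z < u * ((1 + e) * (ln u - 1)) by rewrite ltr_pM2l.
move=> /lt_le_trans; apply; rewrite mulrA [u * _]mulrC.
apply: ler_pM; [|nra|exact: ltW|lra].
by rewrite mulr_ge0 // ltW //; lra.
Qed.

Theorem theorem3 (R : realType) (eps : R) (eps_gt0 : 0 < eps) :
  exists n0 : nat, forall n : nat, (n0 <= n)%N ->
    exists N : nat,
      is_poset_ramsey Lambda (boolean_lattice n) N /\
      (n%:R + 1 / 15 * (n%:R / log2 n%:R) <= N%:R :> R) /\
      (N%:R <= n%:R + (1 + eps) * (n%:R / log2 n%:R) :> R).
Proof.
have [n0 n0P] := fact_gt_pow2_eventually eps_gt0.
(* From [2 ^ 12] on, the logarithm is at least 12, so the slack between the constants 15 and 10
   covers the lower-order terms. *)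
exists (maxn n0 (2 ^ 12)%N) => n; rewrite geq_max => /andP[n0n n_big].
have n_ge : (2 <= n)%N by rewrite (leq_trans _ n_big).
pose u : R := n%:R / log2 n%:R.
have u_ge0 : 0 <= u.
  by rewrite divr_ge0 // divr_ge0 // ln_ge0 // ler1n; lia.
have u15_ge0 : 0 <= 1 / 15 * u by rewrite mulr_ge0 // divr_ge0.
have ueps_ge0 : 0 <= (1 + eps) * u by rewrite mulr_ge0 // addr_ge0 // ltW.
pose k1 := Num.trunc (1 / 15 * u); pose k2 := Num.trunc ((1 + eps) * u).
have /andP[k1_le k1_gt] := truncn_itv u15_ge0.
have /andP[k2_le k2_gt] := truncn_itv ueps_ge0.
have k1_bound := pow2_trunc_log_bound n_ge k1_le.
have tl_ge : (12 <= trunc_log 2 n)%N by rewrite trunc_log_max.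
have k1_tl : (k1 * 12 <= k1 * trunc_log 2 n)%N by rewrite leq_mul2l tl_ge orbT.
have n_lt := trunc_log_ltn n (isT : (1 < 2)%N).
(* One extra bit gives [n < 2 ^ L], a second makes room for [n + k1], as [k1 <= n]. *)
have [||||N [N_ramsey /andP[N_gt N_le]]] := @poset_ramsey_between n k1 (trunc_log 2 n).+2 k2.
- by [].
- by rewrite expnS; move: n_lt k1_bound; rewrite -/k1; lia.
- by move: n_big k1_bound; rewrite -/k1; lia.
- exact: n0P.
exists N; split=> //; split.
  (* The strict bound [n + k1 < N] makes up for the truncation in [k1]. *)
  apply: le_trans (_ : (n + k1).+1%:R <= _); last by rewrite ler_nat.
  by rewrite -addnS natrD lerD2l ltW.
apply: le_trans (_ : (n + k2)%:R <= _); first by rewrite ler_nat.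
by rewrite natrD lerD2l.
Qed.
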